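(* Let $X,Y$ be real Banach spaces and $1\le p\le\infty$. For any $k\in\mathbb{Z}^+$, there exist $k_1,k_2\in\mathbb{Z}^+$ with $k=k_1+k_2-1$ such that the following statements hold. (1) If $X\oplus_pY$ is $k$-WUR, then $X$ is $k_1$-WUR and $Y$ is $k_2$-WUR. (2) If $X\oplus_pY$ is $k$-WLUR, then $X$ is $k_1$-WLUR and $Y$ is $k_2$-WLUR. (3) If $X\oplus_pY$ is $k$-WMLUR, then $X$ is $k_1$-WMLUR and $Y$ is $k_2$-WMLUR.
   Context: $X\oplus_pY$ is $X\times Y$ with the norm $\|(x,y)\|=\|(\|x\|,\|y\|)\|_p$, where $\|\cdot\|_p$ is the $\ell_p$-norm on $\mathbb{R}^2$. For a Banach space $Z$ with unit sphere $S_Z$ and dual $Z^*$, $z_1,\dots,z_{k+1}\in Z$ and $f_1,\dots,f_k\in Z^*$, $D_k[(z_i)_{i=1}^{k+1};(f_j)_{j=1}^{k}]$ denotes the determinant of the $(k+1)\times(k+1)$ matrix whose first row consists of ones and whose $(j+1,i)$ entry is $f_j(z_i)$. For $k\in\mathbb{Z}^+$: $Z$ is $k$-WUR ($k$-weakly uniformly rotund) if for every $\epsilon>0$ and $f_1,\dots,f_k\in S_{Z^*}$, $$\inf\Big(\{1\}\cup\Big\{1-\tfrac{1}{k+1}\Big\|\sum_{i=1}^{k+1}z_i\Big\| : z_1,\dots,z_{k+1}\in S_Z,\ |D_k[(z_i)_{i=1}^{k+1};(f_j)_{j=1}^{k}]|\ge\epsilon\Big\}\Big)>0.$$ $Z$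 is $k$-WLUR ($k$-weakly locally uniformly rotund) if for every $z\in S_Z$, $\epsilon>0$ and $f_1,\dots,f_k\in S_{Z^*}$, $$\inf\Big(\{1\}\cup\Big\{1-\tfrac{1}{k+1}\Big\|z+\sum_{i=1}^{k}z_i\Big\| : z_1,\dots,z_{k}\in S_Z,\ |D_k[z,(z_i)_{i=1}^{k};(f_j)_{j=1}^{k}]|\ge\epsilon\Big\}\Big)>0.$$ $Z$ is $k$-WMLUR ($k$-weakly midpoint locally uniformly rotund) if for any $z\in S_Z$ and any sequences $(z_n^{(1)}),\dots,(z_n^{(k+1)})$ in $S_Z$ with $\|(k+1)z-\sum_{i=1}^{k+1}z_n^{(i)}\|\to0$, it follows that $D_k[(z_n^{(i)})_{i=1}^{k+1};(f_j)_{j=1}^{k}]\to0$ for all $f_1,\dots,f_k\in S_{Z^*}$. *)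

(* Defs.v *)
From HB Require Import structures.
From mathcomp Require Import all_boot all_order all_algebra.
From mathcomp Require Import all_classical all_reals all_analysis.
From mathcomp Require Import ring lra.

Set Implicit Arguments.
Unset Strict Implicit.
Unset Printing Implicit Defensive.

Import Order.TTheory GRing.Theory Num.Theory.
Import numFieldNormedType.Exports.

Local Open Scope classical_set_scope.
Local Open Scope ring_scope.

(* Only exponents in [1, +oo] are meaningful: the last branch is p = +oo. *)
Definition lp_norm2 (R : realType) (p : \bar R) (a b : R) : R :=
  match p with
  | r%:E => (`|a| `^ r + `|b| `^ r) `^ r^-1
  | _ => Num.max `|a| `|b|
  end.

Section lp_norm2_theory.
Variables (R : realType) (p : \bar R).
Hypothesis p1 : (1 <= p)%E.

Lemma lp_norm2_ge0 (a b : R) : 0 <= lp_norm2 p a b.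
Proof. by case: p => [r||] /=; rewrite ?powR_ge0// le_max normr_ge0. Qed.

Lemma lp_norm2Z (l a b : R) : lp_norm2 p (l * a) (l * b) = `|l| * lp_norm2 p a b.
Proof.
case: p p1 => [r||//] /=; rewrite ?lee_fin => r1; last by rewrite !normrM maxr_pMr.
have r0 : r != 0 by rewrite gt_eqF// (lt_le_trans _ r1)// lte01.
rewrite !normrM !powRM// -mulrDr powRM ?addr_ge0 ?powR_ge0//.
by rewrite -powRrM mulfV// powRr1.
Qed.

Lemma lp_norm2_eq0 (a b : R) : lp_norm2 p a b = 0 -> a = 0 /\ b = 0.
Proof.
case: p p1 => [r||//] /=; rewrite ?lee_fin => r1; last first.
  move=> ab0; have : Num.max `|a| `|b| <= 0 by rewrite ab0.
  by rewrite ge_max !normr_le0 => /andP[/eqP -> /eqP ->].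
move/powR_eq0_eq0/eqP; rewrite paddr_eq0 ?powR_ge0// => /andP[/eqP a0 /eqP b0].
by split; apply/normr0_eq0; apply: powR_eq0_eq0; [exact: a0|exact: b0].
Qed.

Lemma le_lp_norm2 (a b a' b' : R) : `|a| <= `|a'| -> `|b| <= `|b'| ->
  lp_norm2 p a b <= lp_norm2 p a' b'.
Proof.
case: p p1 => [r||//] /=; rewrite ?lee_fin => r1 aa bb; last first.
  by rewrite ge_max !le_max aa bb orbT.
have r0 : 0 < r by rewrite (lt_le_trans _ r1)// lte01.
apply: ge0_ler_powR; rewrite ?invr_ge0 ?(ltW r0) ?nnegrE ?addr_ge0 ?powR_ge0//.
by apply: lerD; apply: ge0_ler_powR; rewrite ?(ltW r0) ?nnegrE ?normr_ge0.
Qed.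

Lemma lp_norm2_0r (a : R) : lp_norm2 p a 0 = `|a|.
Proof.
case: p p1 => [r||//] /=; rewrite ?lee_fin => r1; last by rewrite normr0; apply/max_idPl.
have r0 : r != 0 by rewrite gt_eqF// (lt_le_trans _ r1)// lte01.
by rewrite normr0 powR0// addr0 -powRrM mulfV// powRr1.
Qed.

Lemma lp_norm2_0l (a : R) : lp_norm2 p 0 a = `|a|.
Proof.
case: p p1 => [r||//] /=; rewrite ?lee_fin => r1; last by rewrite normr0; apply/max_idPr.
have r0 : r != 0 by rewrite gt_eqF// (lt_le_trans _ r1)// lte01.
by rewrite normr0 powR0// add0r -powRrM mulfV// powRr1.
Qed.

Let lp_norm2_unit (t a b a' b' : R) : 0 <= t <= 1 ->
  0 <= a -> 0 <= b -> 0 <= a' -> 0 <= b' ->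
  lp_norm2 p a b = 1 -> lp_norm2 p a' b' = 1 ->
  lp_norm2 p (t * a + (1 - t) * a') (t * b + (1 - t) * b') <= 1.
Proof.
move=> t01 a0 b0 a'0 b'0; have /andP[t0 t1] := t01.
case: p p1 => [r||//] /=; rewrite ?lee_fin => r1; last first.
  rewrite !ger0_norm ?addr_ge0 ?mulr_ge0 ?subr_ge0// => ab ab'.
  have : Num.max a b <= 1 by rewrite ab.
  have : Num.max a' b' <= 1 by rewrite ab'.
  by rewrite !ge_max => /andP[? ?] /andP[? ?]; apply/andP; split; nra.
have r0 : 0 < r by rewrite (lt_le_trans _ r1)// lte01.
have cvx u v : 0 <= u -> 0 <= v ->
    (t * u + (1 - t) * v) `^ r <= t * u `^ r + (1 - t) * v `^ r.
  move=> u0 v0.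
  have := @convex_powR R r r1 (Itv01 t0 t1) u v.
  by rewrite !inE/= !in_itv/= !andbT => /(_ u0 v0); rewrite !convRE.
have toS u v : (u `^ r + v `^ r) `^ r^-1 = 1 -> u `^ r + v `^ r = 1.
  move=> /(congr1 (fun x => x `^ r)).
  by rewrite -powRrM mulVf ?gt_eqF// powRr1 ?addr_ge0 ?powR_ge0// powR1.
rewrite !ger0_norm ?addr_ge0 ?mulr_ge0 ?subr_ge0// => /toS ab /toS ab'.
apply: (@le_trans _ _ (1 `^ r^-1)); last by rewrite powR1.
apply: ge0_ler_powR;
  rewrite ?invr_ge0 ?(ltW r0) ?nnegrE ?addr_ge0 ?powR_ge0//.
apply: le_trans (lerD (cvx _ _ a0 a'0) (cvx _ _ b0 b'0)) _.
by rewrite addrACA -!mulrDr ab ab' !mulr1 subrKC.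
Qed.

Lemma ler_lp_norm2D (a b a' b' : R) :
  lp_norm2 p (a + a') (b + b') <= lp_norm2 p a b + lp_norm2 p a' b'.
Proof.
set A := lp_norm2 p a b; set B := lp_norm2 p a' b'.
have [A0|A0] := eqVneq A 0.
  by have [-> ->] := lp_norm2_eq0 A0; rewrite A0 !add0r.
have [B0|B0] := eqVneq B 0.
  by have [-> ->] := lp_norm2_eq0 B0; rewrite B0 !addr0.
have Agt0 : 0 < A by rewrite lt_neqAle eq_sym A0 lp_norm2_ge0.
have Bgt0 : 0 < B by rewrite lt_neqAle eq_sym B0 lp_norm2_ge0.
have ABgt0 : 0 < A + B by rewrite addr_gt0.
have ABn0 : A + B != 0 by rewrite gt_eqF.
have N u v : lp_norm2 p `|u| `|v| = lp_norm2 p u v.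
  by rewrite /lp_norm2 !normr_id.
have unit u v : 0 < lp_norm2 p u v ->
    lp_norm2 p ((lp_norm2 p u v)^-1 * `|u|) ((lp_norm2 p u v)^-1 * `|v|) = 1.
  move=> h; rewrite lp_norm2Z N gtr0_norm ?invr_gt0// mulVf//.
  by rewrite gt_eqF.
have t01 : 0 <= A / (A + B) <= 1.
  rewrite divr_ge0 ?(ltW Agt0) ?(ltW ABgt0)//=.
  by rewrite ler_pdivrMr// mul1r lerDl ltW.
have := @lp_norm2_unit (A / (A + B)) (A^-1 * `|a|) (A^-1 * `|b|)
  (B^-1 * `|a'|) (B^-1 * `|b'|) t01.
rewrite !mulr_ge0 ?invr_ge0 ?(ltW Agt0) ?(ltW Bgt0)// !unit//.
move=> /(_ isT isT isT isT erefl erefl).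
have E u v : A / (A + B) * (A^-1 * u) + (1 - A / (A + B)) * (B^-1 * v) =
    (A + B)^-1 * (u + v) by field; rewrite ABn0 A0 B0.
rewrite !E lp_norm2Z gtr0_norm ?invr_gt0// ler_pdivrMl// mulr1.
apply: le_trans; apply: le_lp_norm2;
  by rewrite [leRHS]ger0_norm ?addr_ge0// ler_normD.
Qed.

End lp_norm2_theory.

(* The carrier is that of X * Y, but the norm (hence the topology) attached to
   this alias is the l_p one instead of the library's max norm. *)
Definition lp_sum (R : realType) (p : \bar R) (p1 : (1 <= p)%E)
  (X Y : normedModType R) : Type := (X * Y)%type.

Section lp_sum_normedModType.
Variables (R : realType) (p : \bar R) (p1 : (1 <= p)%E) (X Y : normedModType R).
Local Notation Z := (lp_sum p1 X Y).

HB.instance Definition _ := GRing.Lmodule.copy Z (X * Y)%type.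

Definition lp_sum_norm (z : Z) : R := lp_norm2 p `|z.1| `|z.2|.

Let lp_sum_normD (x y : Z) :
  lp_sum_norm (x + y) <= lp_sum_norm x + lp_sum_norm y.
Proof.
apply: le_trans (ler_lp_norm2D p1 _ _ _ _).
by apply: le_lp_norm2 => //; rewrite normr_id ger0_norm ?addr_ge0// ler_normD.
Qed.

Let lp_sum_normZ (l : R) (x : Z) : lp_sum_norm (l *: x) = `|l| * lp_sum_norm x.
Proof.
rewrite /lp_sum_norm /= !normrZ lp_norm2Z//.
by rewrite normr_id.
Qed.

Let lp_sum_norm0_eq0 (x : Z) : lp_sum_norm x = 0 -> x = 0.
Proof.
case: x => x y /(lp_norm2_eq0 p1)[/normr0_eq0 x0 /normr0_eq0 y0].
by apply/pair_equal_spec; split.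
Qed.

HB.instance Definition _ := Lmodule_isNormed.Build R Z
  lp_sum_normD lp_sum_normZ lp_sum_norm0_eq0.

Lemma lp_sum_normE (z : Z) : `|z| = lp_norm2 p `|z.1| `|z.2|.
Proof. by []. Qed.

End lp_sum_normedModType.

Section lp_sum_complete.
Variables (R : realType) (p : \bar R) (p1 : (1 <= p)%E).
Variables (X Y : completeNormedModType R).
Local Notation Z := (lp_sum p1 X Y).

Let lp_sum_cauchy_cvg (F : set_system Z) :
  ProperFilter F -> cauchy F -> cvg F.
Proof.
move=> FF Fc.
have le1 (z : Z) : `|z.1| <= `|z|.
  rewrite lp_sum_normE -[leLHS]normr_id -(lp_norm2_0r p1).
  by apply: le_lp_norm2; rewrite ?normr0.
have le2 (z : Z) : `|z.2| <= `|z|.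
  rewrite lp_sum_normE -[leLHS]normr_id -(lp_norm2_0l p1).
  by apply: le_lp_norm2; rewrite ?normr0.
have leD (z : Z) : `|z| <= `|z.1| + `|z.2|.
  rewrite lp_sum_normE -[X in lp_norm2 _ X _]addr0 -[X in lp_norm2 _ _ X]add0r.
  apply: le_trans (ler_lp_norm2D p1 _ _ _ _) _.
  by rewrite lp_norm2_0r// lp_norm2_0l// !normr_id.
move/cauchyP : Fc => Fc.
have c1 : cvg ((fun z : Z => z.1) @ F).
  apply: cauchy_cvg; apply/cauchyP => e e0; have [z Fz] := Fc e e0.
  exists z.1.
  suff : F [set w : Z | ball z.1 e w.1] by [].
  apply: filterS Fz => w; rewrite -!ball_normE /=.
  exact: le_lt_trans (le1 (z - w)).
have c2 : cvg ((fun z : Z => z.2) @ F).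
  apply: cauchy_cvg; apply/cauchyP => e e0; have [z Fz] := Fc e e0.
  exists z.2.
  suff : F [set w : Z | ball z.2 e w.2] by [].
  apply: filterS Fz => w; rewrite -!ball_normE /=.
  exact: le_lt_trans (le2 (z - w)).
move/cvg_ex : c1 => [x /cvgrPdist_lt Fx]; move/cvg_ex : c2 => [y /cvgrPdist_lt Fy].
apply/cvg_ex; exists ((x, y) : Z); apply/cvgrPdist_lt => e e0.
have e20 : 0 < e / 2 by rewrite divr_gt0.
have := Fx _ e20; have := Fy _ e20; apply: filterS2 => z hy hx.
apply: le_lt_trans (leD _) _; rewrite (splitr e).
exact: ltrD.
Qed.

HB.instance Definition _ := Uniform_isComplete.Build Z lp_sum_cauchy_cvg.

End lp_sum_complete.

Section weak_rotundity.
Variables (R : realType) (Z : normedModType R).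

Definition unit_sphere : set Z := [set z | `|z| = 1].

Definition dual_norm (f : {linear Z -> R^o}) : R :=
  sup [set `|f z| | z in [set z : Z | `|z| <= 1]].

(* [sup] returns 0 on unbounded sets, so continuity is required separately. *)
Definition dual_unit_sphere : set {linear Z -> R^o} :=
  [set f : {linear Z -> R^o} | continuous f /\ dual_norm f = 1].

Definition Ddet (k : nat) (z : 'I_k.+1 -> Z) (f : 'I_k -> {linear Z -> R^o}) : R :=
  \det (col_mx (const_mx 1 : 'rV[R]_k.+1)
               (\matrix_(j < k, i < k.+1) (f j (z i) : R))).

(* the family z, zs 0, ..., zs (k - 1) *)
Definition fcons (k : nat) (z : Z) (zs : 'I_k -> Z) (i : 'I_k.+1) : Z :=
  if unlift ord0 i is Some j then zs j else z.

Definition WUR (k : nat) : Prop :=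
  forall (e : R) (f : 'I_k -> {linear Z -> R^o}),
    0 < e -> (forall j, dual_unit_sphere (f j)) ->
    0 < inf ([set 1] `|`
      [set 1 - k.+1%:R^-1 * `|\sum_i z i| | z in
        [set z : 'I_k.+1 -> Z |
          (forall i, unit_sphere (z i)) /\ e <= `|Ddet z f|]]).

Definition WLUR (k : nat) : Prop :=
  forall (z : Z) (e : R) (f : 'I_k -> {linear Z -> R^o}),
    unit_sphere z -> 0 < e -> (forall j, dual_unit_sphere (f j)) ->
    0 < inf ([set 1] `|`
      [set 1 - k.+1%:R^-1 * `|z + \sum_i zs i| | zs in
        [set zs : 'I_k -> Z |
          (forall i, unit_sphere (zs i)) /\ e <= `|Ddet (fcons z zs) f|]]).

Definition WMLUR (k : nat) : Prop :=
  forall (z : Z) (zs : 'I_k.+1 -> nat -> Z),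
    unit_sphere z -> (forall i n, unit_sphere (zs i n)) ->
    (fun n => `|k.+1%:R *: z - \sum_i zs i n|) @ \oo --> (0 : R) ->
    forall f : 'I_k -> {linear Z -> R^o},
      (forall j, dual_unit_sphere (f j)) ->
      (fun n => Ddet (fun i => zs i n) f) @ \oo --> (0 : R).

End weak_rotundity.
Arguments WUR {R} Z k.
Arguments WLUR {R} Z k.
Arguments WMLUR {R} Z k.

(* Main.v *)
(* For simplices [x, x_1, .., x_m] in X and [y, y_1, .., y_n] in Y, the points
   c (x, y), c (x_i, y), c (x, y_j), with c = 1 / |(1, 1)|_p, lie on the unit
   sphere of the l_p sum. After subtraction of the first vertex from the others
   the matrix of the functionals (f, 0), (0, g) is block diagonal, so that the
   determinant of the combined simplex is c^(m + n) D(x, x_i; f) D(y, y_j; g).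
   Moreover its vertices have almost maximal sum as soon as this holds in X and
   Y. Hence a failure of m-rotundity of X and of n-rotundity of Y yields a failure
   of (m + n)-rotundity of the sum. Since X and Y inherit k-rotundity from the sum,
   it suffices to take for k1 the least index at which X is k1-rotund. For all
   three statements at once, one applies this to the strongest rotundity enjoyed
   by the sum, as k-WUR implies k-WLUR, which implies k-WMLUR.

   For k-WMLUR, if z is almost the barycenter of z_0, .., z_k then
   D(z_0, z_1, .., z_k) is almost (k + 1) D(z, z_1, .., z_k): one can thus again
   work with simplices having the fixed point z as a vertex. *)
Require Import Defs.
From HB Require Import structures.
From mathcomp Require Import all_boot all_order all_algebra perm.
From mathcomp Require Import all_classical all_reals all_analysis.
From mathcomp Require Import ring lra zify.

Set Implicit Arguments.
Unset Strict Implicit.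
Unset Printing Implicit Defensive.

Import Order.TTheory GRing.Theory Num.Theory.
Import numFieldNormedType.Exports.

Local Open Scope ring_scope.
Local Open Scope classical_set_scope.

(** * Preliminaries on infima and determinants *)

(** The adjoined 1 makes the set nonempty and the hypothesis makes 0 a lower bound, so [inf] is a
    genuine infimum and not a default value. *)
Lemma inf_setU1_gt0P (R : realType) (E : set R) : (forall x, E x -> 0 <= x) ->
  0 < inf ([set 1] `|` E) <-> exists2 d, 0 < d & forall x, E x -> d <= x.
Proof.
move=> E0; split=> [i0|[d d0 dE]].
  exists (inf ([set 1] `|` E)) => // x Ex; apply: ge_inf; last by right.
  by exists 0 => y [->|/E0].
apply: (@lt_le_trans _ _ (Num.min 1 d)); first by rewrite lt_min ltr01.
apply: lb_le_inf; first by exists 1; left.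
by move=> x [->|/dE dx]; rewrite ge_min ?lexx// dx orbT.
Qed.

Lemma det_le_fact (R : realType) (n : nat) (A : 'M[R]_n) :
  (forall i j, `|A i j| <= 1) -> `|\det A| <= n`!%:R.
Proof.
move=> A1; rewrite /determinant (le_trans (ler_norm_sum _ _ _))//.
rewrite -card_Sn -sum1_card natr_sum; apply: ler_sum => s _.
rewrite normrM normrX normrN1 expr1n mul1r normr_prod.
by apply: prodr_ile1 => i _; rewrite normr_ge0 A1.
Qed.

(** * The determinants D_k *)

Section Ddet_theory.
Variables (R : realType) (Z : normedModType R) (k : nat).
Implicit Types (z : Z) (zs : 'I_k -> Z) (f : 'I_k -> {linear Z -> R^o}).

Lemma fconsK (z : 'I_k.+1 -> Z) : fcons (z ord0) (fun i => z (lift ord0 i)) = z.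
Proof. by apply/funext => i; rewrite /fcons; case: unliftP => [j|] ->. Qed.

Lemma fcons0 z zs : fcons z zs ord0 = z.
Proof. by rewrite /fcons unlift_none. Qed.

Lemma fconsS z zs i : fcons z zs (lift ord0 i) = zs i.
Proof. by rewrite /fcons liftK. Qed.

Lemma sum_fcons z zs : \sum_i fcons z zs i = z + \sum_i zs i.
Proof.
rewrite big_ord_recl fcons0; congr (_ + _).
by apply: eq_bigr => i _; rewrite fconsS.
Qed.

Lemma fcons_unit z zs : unit_sphere z -> (forall i, unit_sphere (zs i)) ->
  forall i, unit_sphere (fcons z zs i).
Proof. by move=> z1 zs1 i; rewrite /fcons; case: unlift. Qed.

(** Block matrices need ['I_k.+1] to be read as ['I_(1 + k)]; this lemma and the next one evaluate
    [fcons] on the two parts. *)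
Let fcons_lshift z zs (i : 'I_1) : fcons z zs (lshift k i) = z.
Proof. by rewrite ord1 -[RHS](fcons0 z zs); congr (fcons _ _ _); apply/val_inj. Qed.

Let fcons_rshift z zs (i : 'I_k) : fcons z zs (rshift 1 i) = zs i.
Proof. by rewrite -[RHS](fconsS z zs); congr (fcons _ _ _); apply/val_inj. Qed.

(** Subtracting [f j z] times the row of ones from the row of [f j] clears the first column below
    its leading 1 (left multiplication by [L]). *)
Lemma Ddet_fcons z zs f :
  Ddet (fcons z zs) f = \det (\matrix_(j < k, i < k) (f j (zs i) - f j z : R)).
Proof.
pose C : 'cV[R]_k := \col_j (f j z : R).
pose D : 'M[R]_k := \matrix_(j, i) (f j (zs i) : R).
pose L : 'M[R]_(1 + k) := block_mx 1%:M 0 (- C) 1%:M.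
have -> : Ddet (fcons z zs) f = \det (block_mx 1%:M (const_mx 1) C D).
  congr (\det _); apply/matrixP => i j.
  case: (@split_ordP 1 k i) => i' ->; case: (@split_ordP 1 k j) => j' ->;
    rewrite ?col_mxEu ?col_mxEd ?row_mxEl ?row_mxEr !mxE ?fcons_lshift ?fcons_rshift//.
  by rewrite !ord1.
have -> : \det (block_mx 1%:M (const_mx 1) C D) =
          \det (L *m block_mx 1%:M (const_mx 1) C D).
  by rewrite det_mulmx det_lblock !det1 !mul1r.
rewrite mulmx_block !mul1mx !mul0mx !addr0 mulmx1 addNr det_ublock det1 mul1r.
congr (\det _); apply/matrixP => i j; rewrite !mxE big_ord1 !mxE mulr1.
by rewrite addrC.
Qed.

Lemma dual_unit_sphere_le (f : {linear Z -> R^o}) z :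
  dual_unit_sphere f -> `|f z : R| <= `|z|.
Proof.
move=> [_ f1].
(* Were the set unbounded, its [sup] would be 0, not 1. *)
have Hs : has_sup [set `|f z : R| | z in [set z : Z | `|z| <= 1]].
  apply: contrapT => /sup_out s0; move: f1.
  by rewrite /dual_norm s0 => /eqP; rewrite eq_sym oner_eq0.
have [->|z0] := eqVneq z 0; first by rewrite linear0 !normr0.
have nz : 0 < `|z| by rewrite normr_gt0.
have : `|f (`|z|^-1 *: z) : R| <= 1.
  rewrite -[leRHS]f1; apply: ub_le_sup; first by case: Hs.
  exists (`|z|^-1 *: z) => //=.
  by rewrite normrZ normfV normr_id mulVf// gt_eqF.
by rewrite linearZ /= normrM normfV normr_id ler_pdivrMl// mulr1.
Qed.

(* Adding every column to the first one turns it into [(k + 1, f (z0 + sum zs))],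
   and the determinant is linear in that column. *)
Lemma Ddet_barycenter z0 z zs f : (forall j, dual_unit_sphere (f j)) ->
  (forall i, unit_sphere (zs i)) ->
  `|Ddet (fcons z0 zs) f - k.+1%:R * Ddet (fcons z zs) f| <=
  (k * k`!)%:R * `|k.+1%:R *: z - (z0 + \sum_i zs i)|.
Proof.
move=> f1 zs1; set err := _ *: _ - _.
pose W : 'M[R]_(1 + k, k) :=
  col_mx (const_mx 1) (\matrix_(j < k, i < k) (f j (zs i) : R)).
pose col t u : 'cV[R]_(1 + k) := col_mx (const_mx t) (\col_j (f j u : R)).
have DE u : Ddet (fcons u zs) f = \det (row_mx (col 1 u) W).
  congr (\det _); apply/matrixP => i j.
  case: (@split_ordP 1 k i) => i' ->; case: (@split_ordP 1 k j) => j' ->;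
    by rewrite ?row_mxEl ?row_mxEr ?col_mxEu ?col_mxEd !mxE ?fcons_lshift
      ?fcons_rshift.
have shift v : \det (row_mx v W) = \det (row_mx (v + W *m const_mx 1) W).
  have -> : row_mx (v + W *m const_mx 1) W =
    row_mx v W *m (block_mx 1%:M 0 (const_mx 1) 1%:M : 'M[R]_(1 + k)).
    by rewrite mul_row_block mulmx1 mulmx0 mulmx1 add0r.
  by rewrite det_mulmx det_lblock !det1 !mulr1.
(* Cofactors along the first column do not see that column, so 0 may stand in for it. *)
pose cof (i : 'I_(1 + k)) := cofactor (row_mx 0 W : 'M[R]_(1 + k)) i (lshift k 0).
have expand v : \det (row_mx v W) = \sum_i v i 0 * cof i.
  rewrite (expand_det_col _ (lshift k 0)); apply: eq_bigr => i _.
  rewrite row_mxEl; congr (_ * (_ * \det _)).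
  apply/matrixP => a b; rewrite !mxE.
  have -> : lift (lshift k 0) b = rshift 1 b by apply/val_inj.
  by rewrite (unsplitK (inr b)).
have zE : col 1 z0 + W *m const_mx 1 = k.+1%:R *: col 1 z - col 0 err.
  apply/matrixP => i j; rewrite ord1.
  case: (@split_ordP 1 k i) => i' ->.
    rewrite !mxE !(unsplitK (inl i')) !mxE (eq_bigr (fun=> 1)).
      by rewrite sumr_const card_ord subr0 mulr1 -natr1 addrC.
    by move=> l _; rewrite col_mxEu !mxE mulr1.
  rewrite !mxE !(unsplitK (inr i')) !mxE.
  rewrite /err linearB linearZ /= [f i' (z0 + _)]linearD linear_sum /=.
  rewrite subKr; congr (_ + _).
  by apply: eq_bigr => l _; rewrite col_mxEd !mxE mulr1.
have mE (a : R) (u v : 'cV[R]_(1 + k)) i :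
  (a *: u - v) i 0 = a * u i 0 - v i 0 by rewrite !mxE.
rewrite !DE shift zE !expand mulr_sumr -sumrB.
rewrite (eq_bigr (fun i => - (col 0 err i 0 * cof i))); last first.
  by move=> i _; rewrite mE; ring.
(* The top entry of [col 0 err] is 0. There remain k cofactors, minors of entries bounded by 1 and
   hence at most k! in modulus: this is the constant [k * k!]. *)
rewrite sumrN normrN big_split_ord big_ord1 /= {1}/col col_mxEu mxE mul0r add0r.
rewrite (le_trans (ler_norm_sum _ _ _))//.
apply: (@le_trans _ _ (\sum_(i < k) k`!%:R * `|err|)); last first.
  by rewrite sumr_const card_ord natrM -mulrA -[leLHS]mulr_natl.
apply: ler_sum => i _; rewrite normrM mulrC; apply: ler_pM => //.
  rewrite /cof /cofactor normrM normrX normrN1 expr1n mul1r.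
  apply: det_le_fact => a b; rewrite 2!mxE.
  have -> : lift (lshift k 0) b = rshift 1 b by apply/val_inj.
  rewrite row_mxEr; case: (@split_ordP 1 k (lift (rshift 1 i) a)) => l ->.
    by rewrite col_mxEu mxE normr1.
  by rewrite col_mxEd mxE -(zs1 b) dual_unit_sphere_le.
by rewrite /col col_mxEd mxE dual_unit_sphere_le.
Qed.

End Ddet_theory.

(** As [r] maps the unit ball of [Z] onto that of [X], with [i] giving preimages, both functionals
    take the same absolute values on the balls. *)
Lemma dual_unit_sphere_comp (R : realType) (X Z : normedModType R)
    (i : {linear X -> Z}) (r : {linear Z -> X}) (f : {linear X -> R^o}) :
  (forall x, `|i x| = `|x|) -> (forall z, `|r z| <= `|z|) -> cancel i r ->
  dual_unit_sphere f -> dual_unit_sphere (f \o r : {linear Z -> R^o}).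
Proof.
move=> iN rN irK [fc f1]; split.
  move=> z; apply: continuous_comp; last exact: fc.
  move: z; apply: bounded_linear_continuous; apply/linear_boundedP.
  by near=> M => z; rewrite (le_trans (rN z))// ler_peMl//; near: M; apply: nbhs_pinfty_ge.
rewrite -f1 /dual_norm; congr sup; apply/seteqP; split => _ [] z /= z1 <-.
  by exists (r z) => //=; rewrite (le_trans (rN z)).
by exists (i z); rewrite /= ?irK// iN.
Unshelve. all: by end_near. Qed.

(** * A common form of the three rotundity notions *)

Section local_rotundity.
Variable R : realType.
Implicit Type mid : bool.

(* [mid = true] is the closeness of WMLUR, [z0] being the vertex that [z] replaces;
   [mid = false] is that of WUR and WLUR. *)
Definition near_bary mid (Z : normedModType R) k (d : R) (z : Z)
    (zs : 'I_k -> Z) : Prop :=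
  if mid then
    exists2 z0, unit_sphere z0 & `|k.+1%:R *: z - (z0 + \sum_i zs i)| < d
  else k.+1%:R - d < `|z + \sum_i zs i|.

(** [S] is the set of base vertices over which [d] is uniform. With [mid = false], the whole sphere
    gives WUR and singletons give WLUR; with [mid = true], singletons give WMLUR. *)
Definition loc_rot mid (Z : normedModType R) (S : set Z) k : Prop :=
  forall (e : R) (f : 'I_k -> {linear Z -> R^o}), 0 < e ->
    (forall j, dual_unit_sphere (f j)) ->
    exists2 d : R, 0 < d & forall z zs, S z -> (forall i, unit_sphere (zs i)) ->
      near_bary mid d z zs -> `|Ddet (fcons z zs) f| < e.

Lemma not_loc_rot mid (Z : normedModType R) (S : set Z) k :
  ~ loc_rot mid S k -> exists (e : R) (f : 'I_k -> {linear Z -> R^o}),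
    [/\ 0 < e, forall j, dual_unit_sphere (f j) &
      forall d, 0 < d -> exists z zs, [/\ S z, forall i, unit_sphere (zs i),
        near_bary mid d z zs & e <= `|Ddet (fcons z zs) f|]].
Proof.
move=> nl; apply: contrapT => H; apply: nl => e f e0 f1.
apply: contrapT => nd; apply: H; exists e, f; split => // d d0.
apply: contrapT => nz; apply: nd; exists d => // z zs Sz zs1 nearz.
by rewrite ltNge; apply/negP => De; apply: nz; exists z, zs.
Qed.

Lemma sub_loc_rot mid (Z : normedModType R) (S T : set Z) k :
  S `<=` T -> loc_rot mid T k -> loc_rot mid S k.
Proof.
move=> ST TP e f e0 f1; have [d d0 H] := TP e f e0 f1.
by exists d => // z zs /ST; exact: H.
Qed.

(** Since (k + 2) z is the sum of z + sum zs, z0 and the error, the norm of z + sum zs exceeds (k +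
    2) - 1 - d: the same [d] works. *)
Lemma loc_rot_mid (Z : normedModType R) (S : set Z) k :
  S `<=` unit_sphere (Z:=Z) -> loc_rot false S k -> loc_rot true S k.
Proof.
move=> S1 SP e f e0 f1; have [d d0 H] := SP e f e0 f1.
exists d => // z zs Sz zs1 [z0 z01 err]; apply: H => //; rewrite /near_bary.
have : `|k.+2%:R *: z| <= `|z + \sum_i zs i| + `|z0| +
    `|k.+1%:R *: z - (z0 + \sum_i zs i)|.
  apply: le_trans (lerD (ler_normD _ _) (lexx _)); apply: le_trans (ler_normD _ _).
  by rewrite -(addrA z) (addrC _ z0) -addrA subrKC -natr1 addrC scalerDl scale1r addrC.
rewrite normrZ (S1 _ Sz) z01 mulr1 normr_nat -natr1; lra.
Qed.

(** [near_bary] uses the sum of the vertices and not their mean, hence the factor k + 1 between the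
    two moduli. *)
Lemma WURP (Z : normedModType R) k : WUR Z k <-> loc_rot false (unit_sphere (Z:=Z)) k.
Proof.
have k0 : 0 < k.+1%:R :> R by rewrite ltr0n.
have E0 (e : R) (f : 'I_k -> {linear Z -> R^o}) x :
    [set 1 - k.+1%:R^-1 * `|\sum_i z i| | z in [set z : 'I_k.+1 -> Z |
          (forall i, unit_sphere (z i)) /\ e <= `|Ddet z f|]] x -> 0 <= x.
  move=> [z [z1 _] <-]; rewrite subr_ge0 ler_pdivrMl// mulr1.
  rewrite (le_trans (ler_norm_sum _ _ _))// (eq_bigr (fun=> 1)) => [|i _].
    by rewrite sumr_const card_ord.
  exact: z1.
split=> [W e f e0 f1|W e f e0 f1].
  have /(inf_setU1_gt0P (@E0 e f))[d d0 dE] := W e f e0 f1.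
  exists (k.+1%:R * d); first exact: mulr_gt0.
  move=> z zs z1 zs1; rewrite /near_bary -sum_fcons => nz.
  rewrite ltNge; apply/negP => De.
  have := dE _ (imageP _ (conj (fcons_unit z1 zs1) De)).
  rewrite lerBrDr -lerBrDl ler_pdivrMl// mulrBr mulr1 => /(lt_le_trans nz).
  by rewrite ltxx.
have [d d0 H] := W e f e0 f1.
apply/(inf_setU1_gt0P (@E0 e f)); exists (k.+1%:R^-1 * d).
  by rewrite mulr_gt0// invr_gt0.
move=> _ [z [z1 De] <-]; rewrite leNgt; apply/negP => nz; move: De.
rewrite -[z]fconsK leNgt H// /near_bary -sum_fcons fconsK.
move: nz; rewrite -(ltr_pM2l k0) mulrBr !mulrA mulfV ?gt_eqF// !mul1r mulr1.
by rewrite ltrBlDr ltrBlDl addrC.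
Qed.

Lemma WLURP (Z : normedModType R) k : WLUR Z k <->
  forall z : Z, unit_sphere z -> loc_rot false [set z] k.
Proof.
have k0 : 0 < k.+1%:R :> R by rewrite ltr0n.
have E0 (z : Z) (z1 : unit_sphere z) (e : R) (f : 'I_k -> {linear Z -> R^o}) x :
    [set 1 - k.+1%:R^-1 * `|z + \sum_i zs i| | zs in [set zs : 'I_k -> Z |
       (forall i, unit_sphere (zs i)) /\ e <= `|Ddet (fcons z zs) f|]] x -> 0 <= x.
  move=> [zs [zs1 _] <-]; rewrite subr_ge0 ler_pdivrMl// mulr1 -sum_fcons.
  rewrite (le_trans (ler_norm_sum _ _ _))// (eq_bigr (fun=> 1)) => [|i _].
    by rewrite sumr_const card_ord.
  exact: fcons_unit.
split=> [W z z1 e f e0 f1|W z e f z1 e0 f1].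
  have /(inf_setU1_gt0P (@E0 z z1 e f))[d d0 dE] := W z e f z1 e0 f1.
  exists (k.+1%:R * d); first exact: mulr_gt0.
  move=> _ zs -> zs1; rewrite /near_bary => nz.
  rewrite ltNge; apply/negP => De.
  have := dE _ (imageP _ (conj zs1 De)).
  rewrite lerBrDr -lerBrDl ler_pdivrMl// mulrBr mulr1 => /(lt_le_trans nz).
  by rewrite ltxx.
have [d d0 H] := W z z1 e f e0 f1.
apply/(inf_setU1_gt0P (@E0 z z1 e f)); exists (k.+1%:R^-1 * d).
  by rewrite mulr_gt0// invr_gt0.
move=> _ [zs [zs1 De] <-]; rewrite leNgt; apply/negP => nz; move: De.
rewrite leNgt H// /near_bary.
move: nz; rewrite -(ltr_pM2l k0) mulrBr !mulrA mulfV ?gt_eqF// !mul1r mulr1.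
by rewrite ltrBlDr ltrBlDl addrC.
Qed.

(** WMLUR concerns the simplex (z0, zs), [loc_rot] the simplex (z, zs); [Ddet_barycenter] compares
    them. From left to right, bad simplices with error below 1 / (n + 1) form a sequence violating
    WMLUR. *)
Lemma WMLURP (Z : normedModType R) k : WMLUR Z k <->
  forall z : Z, unit_sphere z -> loc_rot true [set z] k.
Proof.
have k0 : 1 <= k.+1%:R :> R by rewrite ler1n.
split=> [W z z1|W z zs z1 zs1 zz f f1].
  apply: contrapT => /not_loc_rot[e [f [e0 f1 H]]].
  have /choice[g gP] (n : nat) : exists u : Z * ('I_k -> Z),
      [/\ unit_sphere u.1, forall i, unit_sphere (u.2 i),
        `|k.+1%:R *: z - (u.1 + \sum_i u.2 i)| < n.+1%:R^-1 &
        e <= `|Ddet (fcons z u.2) f|].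
    have [|_ [zs [-> zs1 [z0 z01 err] De]]] := H n.+1%:R^-1.
      by rewrite invr_gt0.
    by exists (z0, zs).
  have : (fun n => Ddet (fcons (g n).1 (g n).2) f) @ \oo --> (0 : R).
    apply: (W z (fun i n => fcons (g n).1 (g n).2 i)) => //.
      by move=> i n; have [? ? _ _] := gP n; exact: fcons_unit.
    apply/cvgr0Pnorm_lt => d d0.
    near=> n; rewrite normr_id sum_fcons; have [_ _ /lt_trans-> //] := gP n.
    by near: n; exact: (near_infty_natSinv_lt (PosNum d0)).
  pose C : R := (k * k`!)%:R; have C0 : 0 <= C by rewrite ler0n.
  (* An error this small costs less than e / 2 in [Ddet_barycenter]; the other half of e bounds the
     determinant of the sequence. Using C + 1 avoids a zero divisor when k = 0. *)
  have d0 : 0 < e / 2 / (C + 1) by rewrite !divr_gt0// ltr_wpDl.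
  move=> /cvgr0Pnorm_lt/(_ (e / 2)) []; first by rewrite divr_gt0.
  move=> N _ NP.
  have [M _ MP] := near_infty_natSinv_lt (PosNum d0).
  have := NP (maxn N M) (leq_maxl N M); have := MP (maxn N M) (leq_maxr N M) => /=.
  set n := maxn N M; have [_ u1 err De] := gP n => /(lt_trans err).
  rewrite ltr_pdivlMr ?ltr_wpDl// => errC Dn.
  have := Ddet_barycenter (g n).1 z f1 u1; rewrite -/C => B.
  have {}De : e <= k.+1%:R * `|Ddet (fcons z (g n).2) f|.
    by rewrite (le_trans De)// ler_peMl.
  have : k.+1%:R * `|Ddet (fcons z (g n).2) f| <= `|Ddet (fcons (g n).1 (g n).2) f| +
      `|Ddet (fcons (g n).1 (g n).2) f - k.+1%:R * Ddet (fcons z (g n).2) f|.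
    rewrite -[k.+1%:R in leLHS]normr_nat -normrM -lerBlDl.
    by rewrite (le_trans (lerB_dist _ _))// distrC.
  have := normr_ge0 (k.+1%:R *: z - ((g n).1 + \sum_i (g n).2 i)).
  by nra.
apply/cvgr0Pnorm_lt => e e0.
pose C : R := (k * k`!)%:R; have C0 : 0 <= C by rewrite ler0n.
have d0 : 0 < e / 2 / (C + 1) by rewrite !divr_gt0// ltr_wpDl.
(* The determinant at z gets multiplied by k + 1 when z is replaced by z0. *)
have e20 : 0 < e / 2 / k.+1%:R by rewrite !divr_gt0.
have [d' d'0 H] := W z z1 _ f e20 f1.
move/cvgr0Pnorm_lt : zz => zz.
near=> n.
have : `|k.+1%:R *: z - \sum_i zs i n| < d'.
  by rewrite -normr_id; near: n; exact: zz.
have : `|k.+1%:R *: z - \sum_i zs i n| < e / 2 / (C + 1).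
  by rewrite -normr_id; near: n; exact: zz.
rewrite ltr_pdivlMr ?ltr_wpDl//.
rewrite big_ord_recl -[X in Ddet X]fconsK => errC err.
have u1 i : unit_sphere (zs (lift ord0 i) n) by [].
have := H z (fun i => zs (lift ord0 i) n) erefl u1 (ex_intro2 _ _ _ (zs1 ord0 n) err).
rewrite ltr_pdivlMr ?(lt_le_trans ltr01)// => De.
have := Ddet_barycenter (zs ord0 n) z f1 u1; rewrite -/C => B.
set D0 := Ddet _ _ in B *; set D1 := Ddet _ _ in De B.
have : `|D0| <= `|D0 - k.+1%:R * D1| + k.+1%:R * `|D1|.
  by rewrite -[X in X * `|_|]normr_nat -normrM -lerBlDr lerB_dist.
move: B; set E := `|_ *: z - _| in errC *.
have := normr_ge0 (k.+1%:R *: z - (zs ord0 n + \sum_i zs (lift ord0 i) n)).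
by rewrite -/E; nra.
Unshelve. all: by end_near. Qed.

(** Push simplices forward by [i] and compose functionals with [r]: the determinants do not change
    because [r] undoes [i]. *)
Lemma loc_rot_retract mid (X Z : normedModType R) (i : {linear X -> Z})
    (r : {linear Z -> X}) (S : set X) k :
  (forall x, `|i x| = `|x|) -> (forall z, `|r z| <= `|z|) -> cancel i r ->
  loc_rot mid (i @` S) k -> loc_rot mid S k.
Proof.
move=> iN rN irK H e f e0 f1.
have [|d d0 {}H] := H e (fun j => f j \o r) e0.
  by move=> j; exact: (@dual_unit_sphere_comp _ _ _ i r).
exists d => // x xs Sx xs1 nx.
have := H (i x) (i \o xs) (imageP _ Sx); rewrite !Ddet_fcons.
under eq_mx do rewrite /= !irK.
apply=> [l|]; first by rewrite /unit_sphere/= iN xs1.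
move: nx; rewrite /near_bary /= -linear_sum; case: mid {H} => [[x0 x01 err]|].
  exists (i x0); first by rewrite /unit_sphere/= iN.
  by rewrite -linearD -linearZ -linearB iN.
by rewrite -linearD iN.
Qed.

End local_rotundity.

(** * Coordinate maps and the normalised diagonal of the l_p sum *)

Section lp_sum_rotundity.
Variables (R : realType) (X Y : normedModType R) (p : \bar R) (p1 : (1 <= p)%E).
Local Notation Z := (lp_sum p1 X Y).

Definition lp_fst (z : Z) : X := z.1.
Definition lp_snd (z : Z) : Y := z.2.
Definition lp_inl (x : X) : Z := (x, 0).
Definition lp_inr (y : Y) : Z := (0, y).

Let lp_fst_linear : linear lp_fst. Proof. by []. Qed.
Let lp_snd_linear : linear lp_snd. Proof. by []. Qed.
Let lp_inl_linear : linear lp_inl.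
Proof. by move=> a x y; apply/pair_equal_spec; rewrite /= scaler0 addr0. Qed.
Let lp_inr_linear : linear lp_inr.
Proof. by move=> a x y; apply/pair_equal_spec; rewrite /= scaler0 addr0. Qed.

HB.instance Definition _ := GRing.isLinear.Build R Z X *:%R lp_fst lp_fst_linear.
HB.instance Definition _ := GRing.isLinear.Build R Z Y *:%R lp_snd lp_snd_linear.
HB.instance Definition _ := GRing.isLinear.Build R X Z *:%R lp_inl lp_inl_linear.
HB.instance Definition _ := GRing.isLinear.Build R Y Z *:%R lp_inr lp_inr_linear.

Lemma norm_lp_inl x : `|lp_inl x| = `|x|.
Proof. by rewrite lp_sum_normE /= normr0 lp_norm2_0r// normr_id. Qed.

Lemma norm_lp_inr y : `|lp_inr y| = `|y|.
Proof. by rewrite lp_sum_normE /= normr0 lp_norm2_0l// normr_id. Qed.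

Lemma norm_lp_fst z : `|lp_fst z| <= `|z|.
Proof.
rewrite lp_sum_normE -[leLHS]normr_id -(lp_norm2_0r p1).
by apply: le_lp_norm2; rewrite ?normr0.
Qed.

Lemma norm_lp_snd z : `|lp_snd z| <= `|z|.
Proof.
rewrite lp_sum_normE -[leLHS]normr_id -(lp_norm2_0l p1).
by apply: le_lp_norm2; rewrite ?normr0.
Qed.

Definition lp_diag_scale : R := (lp_norm2 p 1 1)^-1.

Lemma lp_norm2_11_gt0 : 0 < lp_norm2 p 1 1 :> R.
Proof.
rewrite lt_neqAle lp_norm2_ge0// andbT eq_sym; apply/eqP => /(lp_norm2_eq0 p1)[].
by move/eqP; rewrite oner_eq0.
Qed.

Lemma lp_diag_scale_gt0 : 0 < lp_diag_scale.
Proof. by rewrite invr_gt0 lp_norm2_11_gt0. Qed.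

Definition lp_diag (x : X) (y : Y) : Z := lp_diag_scale *: ((x, y) : Z).

Lemma lp_diagZ a x y : lp_diag (a *: x) (a *: y) = a *: lp_diag x y.
Proof. by rewrite /lp_diag scalerA mulrC -scalerA. Qed.

Lemma lp_diagD x y x' y' : lp_diag (x + x') (y + y') = lp_diag x y + lp_diag x' y'.
Proof. by rewrite -scalerDr. Qed.

Lemma lp_diagB x y x' y' : lp_diag (x - x') (y - y') = lp_diag x y - lp_diag x' y'.
Proof. by rewrite -scalerBr. Qed.

Lemma lp_diag_sum n (x : 'I_n -> X) (y : 'I_n -> Y) :
  lp_diag (\sum_i x i) (\sum_i y i) = \sum_i lp_diag (x i) (y i).
Proof.
rewrite -scaler_sumr; congr (_ *: _); rewrite [RHS]surjective_pairing.
by congr pair; [rewrite (raddf_sum lp_fst)|rewrite (raddf_sum lp_snd)].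
Qed.

Let norm_lp_diagE x y : `|lp_diag x y| = lp_diag_scale * lp_norm2 p `|x| `|y|.
Proof. by rewrite normrZ gtr0_norm ?lp_diag_scale_gt0. Qed.

Let lp_norm2_cst m : 0 <= m -> lp_diag_scale * lp_norm2 p m m = m.
Proof.
move=> m0; rewrite -[m in lp_norm2 _ m m]mulr1 lp_norm2Z// ger0_norm//.
by rewrite mulrCA mulVf ?mulr1// gt_eqF// lp_norm2_11_gt0.
Qed.

(** By [lp_norm2_cst] the scaled norm of (m, m) is m, so monotonicity of the l_p norm gives this
    bound and the next. The lower one serves almost maximal sums, the upper one midpoint errors. *)
Lemma norm_lp_diag_min x y : Num.min `|x| `|y| <= `|lp_diag x y|.
Proof.
have m0 : 0 <= Num.min `|x| `|y| by rewrite le_min !normr_ge0.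
rewrite norm_lp_diagE -[leLHS]lp_norm2_cst// ler_pM2l ?lp_diag_scale_gt0//.
by apply: le_lp_norm2; rewrite // ger0_norm// normr_id ge_min lexx// orbT.
Qed.

Lemma norm_lp_diag_max x y : `|lp_diag x y| <= Num.max `|x| `|y|.
Proof.
have m0 : 0 <= Num.max `|x| `|y| by rewrite le_max !normr_ge0.
rewrite norm_lp_diagE -[leRHS]lp_norm2_cst// ler_pM2l ?lp_diag_scale_gt0//.
by apply: le_lp_norm2; rewrite // normr_id ger0_norm// le_max lexx// orbT.
Qed.

Lemma lp_diag_unit x y : unit_sphere x -> unit_sphere y -> unit_sphere (lp_diag x y).
Proof.
rewrite /unit_sphere /= => x1 y1; apply/le_anti/andP; split.
  by rewrite (le_trans (norm_lp_diag_max _ _))// x1 y1 maxxx.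
by rewrite (le_trans _ (norm_lp_diag_min _ _))// x1 y1 minxx.
Qed.

Lemma loc_rot_lp_inl mid S k :
  loc_rot mid (lp_inl @` S) k -> loc_rot mid S k.
Proof. exact: (loc_rot_retract norm_lp_inl norm_lp_fst). Qed.

Lemma loc_rot_lp_inr mid S k :
  loc_rot mid (lp_inr @` S) k -> loc_rot mid S k.
Proof. exact: (loc_rot_retract norm_lp_inr norm_lp_snd). Qed.

(** * Combining a simplex of X with a simplex of Y *)

Section simplices.
Variables (m n : nat) (x : X) (xs : 'I_m -> X) (y : Y) (ys : 'I_n -> Y).

Definition lp_simplex (l : 'I_(m + n)) : Z :=
  match fintype.split l with
  | inl i => lp_diag (xs i) y
  | inr j => lp_diag x (ys j)
  end.

Definition lp_functionals (f : 'I_m -> {linear X -> R^o})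
    (g : 'I_n -> {linear Y -> R^o}) (l : 'I_(m + n)) : {linear Z -> R^o} :=
  match fintype.split l with
  | inl i => f i \o lp_fst
  | inr j => g j \o lp_snd
  end.

Lemma Ddet_lp_simplex f g :
  Ddet (fcons (lp_diag x y) lp_simplex) (lp_functionals f g) =
  lp_diag_scale ^+ (m + n) * (Ddet (fcons x xs) f * Ddet (fcons y ys) g).
Proof.
rewrite !Ddet_fcons -(det_ublock _ 0) -detZ; congr (\det _).
apply/matrixP => i j; rewrite 2!mxE.
case: (split_ordP i) => i' ->; case: (split_ordP j) => j' ->;
  rewrite ?block_mxEul ?block_mxEur ?block_mxEdl ?block_mxEdr
    /lp_functionals /lp_simplex ?(unsplitK (inl _)) ?(unsplitK (inr _))
    -linearB /lp_diag -scalerBr linearZ /=; congr (_ * _);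
  (* An edge from the base vertex has only one nonzero coordinate, so the off-diagonal blocks
     vanish. *)
  by rewrite ?mxE /lp_fst /lp_snd /= ?subrr ?linear0 ?linearB.
Qed.

Lemma sum_lp_simplex : \sum_l lp_simplex l =
  lp_diag (\sum_i xs i + n%:R *: x) (\sum_j ys j + m%:R *: y).
Proof.
rewrite big_split_ord /=.
rewrite (eq_bigr (fun i => lp_diag (xs i) y)) => [|i _]; last first.
  by rewrite /lp_simplex (unsplitK (inl i)).
rewrite [X in _ + X](eq_bigr (fun j => lp_diag x (ys j))) => [|j _]; last first.
  by rewrite /lp_simplex (unsplitK (inr j)).
rewrite -!lp_diag_sum -lp_diagD !sumr_const !card_ord !scaler_nat.
by rewrite [y *+ m + _]addrC.
Qed.

Lemma near_bary_lp_simplex mid d :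
  unit_sphere x -> (forall i, unit_sphere (xs i)) ->
  unit_sphere y -> (forall j, unit_sphere (ys j)) -> 0 < d ->
  near_bary mid d x xs -> near_bary mid d y ys ->
  near_bary mid ((m + n).+1%:R * d) (lp_diag x y) lp_simplex.
Proof.
move=> x1 xs1 y1 ys1 d0; rewrite /near_bary sum_lp_simplex; case: mid.
  move=> [x0 x01 xerr] [y0 y01 yerr]; exists (lp_diag x0 y0).
    exact: lp_diag_unit.
  (* The b extra copies of v cancel, so each coordinate keeps its original error. *)
  have E (V : lmodType R) a b (v v0 s : V) :
      (a + b).+1%:R *: v - (v0 + (s + b%:R *: v)) = a.+1%:R *: v - (v0 + s).
    by rewrite -addSn natrD scalerDl !addrA opprD addrACA subrr addr0.
  rewrite -lp_diagD -lp_diagZ -lp_diagB E addnC E.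
  rewrite (le_lt_trans (norm_lp_diag_max _ _))//.
  have dd : d <= (n + m).+1%:R * d by rewrite ler_peMl ?ler1n// ltW.
  by rewrite gt_max !(lt_le_trans _ dd).
(* Write (b + 1)(v + sum vs) as the wanted vector plus b times sum vs, whose norm is at most ab. As
   (b + 1)(a + 1 - d) - ab = a + b + 1 - (b + 1) d, the loss is at most (a + b + 1) d. *)
have N (V : normedModType R) a b (v : V) (vs : 'I_a -> V) :
    unit_sphere v -> (forall i, unit_sphere (vs i)) ->
    a.+1%:R - d < `|v + \sum_i vs i| ->
    (a + b).+1%:R - (a + b).+1%:R * d < `|v + (\sum_i vs i + b%:R *: v)|.
  move=> v1 vs1 H.
  have vs_le : `|\sum_i vs i| <= a%:R.
    rewrite (le_trans (ler_norm_sum _ _ _))// (eq_bigr (fun=> 1)) => [|i _].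
      by rewrite sumr_const card_ord.
    exact: vs1.
  have E : b.+1%:R *: (v + \sum_i vs i) =
      v + (\sum_i vs i + b%:R *: v) + b%:R *: \sum_i vs i.
    by rewrite -natr1 scalerDl scale1r scalerDr addrC !addrA.
  have : b.+1%:R * `|v + \sum_i vs i| <=
      `|v + (\sum_i vs i + b%:R *: v)| + b%:R * `|\sum_i vs i|.
    rewrite -[X in X * `|v + _|]normr_nat -[X in _ + X * _]normr_nat -!normrZ E.
    exact: ler_normD.
  have a0 : 0 <= a%:R :> R by [].
  have b0 : 0 <= b%:R :> R by [].
  move: H; rewrite -!natr1 natrD; nra.
move=> xn yn; rewrite -lp_diagD; apply: lt_le_trans (norm_lp_diag_min _ _).
by rewrite lt_min N//= addnC N.
Qed.

End simplices.

Lemma loc_rot_lp_diag mid (S : set X) (T : set Y) m n :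
  S `<=` unit_sphere (Z:=X) -> T `<=` unit_sphere (Z:=Y) ->
  loc_rot mid [set lp_diag x y | x in S & y in T] (m + n) ->
  loc_rot mid S m \/ loc_rot mid T n.
Proof.
move=> S1 T1 H; apply: contrapT => /not_orP[].
move=> /not_loc_rot[e [f [e0 f1 Hf]]] /not_loc_rot[e' [g [e'0 g1 Hg]]].
have c0 : 0 < lp_diag_scale ^+ (m + n) * (e * e').
  by rewrite !mulr_gt0// exprn_gt0// lp_diag_scale_gt0.
have [|d d0 {}H] := H _ (lp_functionals f g) c0.
  move=> l; rewrite /lp_functionals; case: fintype.split => j.
    exact: (dual_unit_sphere_comp norm_lp_inl norm_lp_fst).
  exact: (dual_unit_sphere_comp norm_lp_inr norm_lp_snd).
have N0 : 0 < (m + n).+1%:R :> R by rewrite ltr0n.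
(* This compensates the factor m + n + 1 lost in [near_bary_lp_simplex]. *)
have d'0 : 0 < (m + n).+1%:R^-1 * d by rewrite mulr_gt0// invr_gt0.
have [x [xs [Sx xs1 nx Dx]]] := Hf _ d'0.
have [y [ys [Ty ys1 ny Dy]]] := Hg _ d'0.
have x1 := S1 _ Sx; have y1 := T1 _ Ty.
have := H (lp_diag x y) (lp_simplex x xs y ys).
rewrite Ddet_lp_simplex normrM gtr0_norm ?exprn_gt0 ?lp_diag_scale_gt0//.
rewrite ltr_pM2l ?exprn_gt0 ?lp_diag_scale_gt0// normrM.
suff : e * e' <= `|Ddet (fcons x xs) f| * `|Ddet (fcons y ys) g|.
  rewrite leNgt => /negP De H'; apply: De; apply: H'.
  - by exists x => //; exists y.
  - move=> l; rewrite /lp_simplex; case: fintype.split => j; exact: lp_diag_unit.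
  - have := near_bary_lp_simplex x1 xs1 y1 ys1 d'0 nx ny.
    by rewrite mulrA mulfV ?gt_eqF// mul1r.
by rewrite ler_pM// ltW.
Qed.

End lp_sum_rotundity.

(** * Choice of the indices and conclusion *)

(** Take a least with [A a], and b = k + 1 - a. If a = 1 then b = k; otherwise (a - 1) + b = k and
    [A] fails at a - 1, so [B b] holds. *)
Lemma split_index (A B : nat -> Prop) k : (0 < k)%N -> A k -> B k ->
  (forall a b, (0 < a)%N -> (0 < b)%N -> (a + b)%N = k -> A a \/ B b) ->
  exists a b, [/\ (0 < a)%N, (0 < b)%N & k = (a + b - 1)%N] /\ (A a /\ B b).
Proof.
move=> k0 Ak Bk AB.
have exA : exists a, (0 < a)%N && `[< A a >] by exists k; rewrite k0; apply/asboolP.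
case: (ex_minnP exA) => a /andP[a0 /asboolP Aa] amin.
have ak : (a <= k)%N by apply: amin; rewrite k0; apply/asboolP.
exists a, (k.+1 - a)%N; split.
  by split => //; [rewrite subn_gt0 ltnS|rewrite subnKC ?leqW// subn1].
split => //; have [a1|a1] := leqP a 1.
  by rewrite (_ : a = 1%N) ?subn1//; apply/eqP; rewrite eqn_leq a1.
case: (AB a.-1 (k.+1 - a)%N) => //.
- by rewrite -ltnS prednK.
- by rewrite subn_gt0 ltnS.
- by rewrite -subn1 addnBA ?leqW// addnC; lia.
- move=> Aa1; have /amin : (0 < a.-1)%N && `[< A a.-1 >].
    by apply/andP; split; [lia|apply/asboolP].
  by lia.
Qed.

Theorem theorem4p10 (R : realType) (X Y : completeNormedModType R)
    (p : \bar R) (p1 : (1 <= p)%E) (k : nat) (k_gt0 : (0 < k)%N) :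
  exists k1 k2 : nat,
    [/\ (0 < k1)%N, (0 < k2)%N & k = (k1 + k2 - 1)%N] /\
    [/\ WUR (lp_sum p1 X Y) k -> WUR X k1 /\ WUR Y k2,
        WLUR (lp_sum p1 X Y) k -> WLUR X k1 /\ WLUR Y k2 &
        WMLUR (lp_sum p1 X Y) k -> WMLUR X k1 /\ WMLUR Y k2].
Proof.
have U_L (Z : normedModType R) j : WUR Z j -> WLUR Z j.
  move=> /WURP W; apply/WLURP => z z1; by apply: sub_loc_rot W => _ ->.
have L_M (Z : normedModType R) j : WLUR Z j -> WMLUR Z j.
  move=> /WLURP W; apply/WMLURP => z z1; by apply: loc_rot_mid (W z z1) => _ ->.
have splitU : WUR (lp_sum p1 X Y) k -> exists k1 k2,
    [/\ (0 < k1)%N, (0 < k2)%N & k = (k1 + k2 - 1)%N] /\ (WUR X k1 /\ WUR Y k2).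
  move=> /WURP W; apply: split_index => //.
  - apply/WURP/(@loc_rot_lp_inl _ _ Y _ p1); apply: sub_loc_rot W => _ [x x1 <-].
    by rewrite /unit_sphere/= norm_lp_inl.
  - apply/WURP/(@loc_rot_lp_inr _ X _ _ p1); apply: sub_loc_rot W => _ [x x1 <-].
    by rewrite /unit_sphere/= norm_lp_inr.
  - move=> a b _ _ ab; rewrite !WURP; apply: (@loc_rot_lp_diag _ _ _ _ p1) => //.
    rewrite ab; apply: sub_loc_rot W => _ [x x1 [y y1 <-]].
    exact: lp_diag_unit.
have split_local mid : (forall z : lp_sum p1 X Y, unit_sphere z ->
    loc_rot mid [set z] k) -> exists k1 k2,
    [/\ (0 < k1)%N, (0 < k2)%N & k = (k1 + k2 - 1)%N] /\
    ((forall x : X, unit_sphere x -> loc_rot mid [set x] k1) /\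
     (forall y : Y, unit_sphere y -> loc_rot mid [set y] k2)).
  move=> W; apply: (@split_index
    (fun j => forall x : X, unit_sphere x -> loc_rot mid [set x] j)
    (fun j => forall y : Y, unit_sphere y -> loc_rot mid [set y] j)) => //.
  - move=> x x1; apply: (@loc_rot_lp_inl _ _ Y _ p1); rewrite image_set1.
    by apply: W; rewrite /unit_sphere/= norm_lp_inl.
  - move=> y y1; apply: (@loc_rot_lp_inr _ X _ _ p1); rewrite image_set1.
    by apply: W; rewrite /unit_sphere/= norm_lp_inr.
  (* Fix x and y at which rotundity fails; the hypothesis is then needed only at the single point
     [lp_diag x y]. *)
  - move=> a b _ _ ab; apply: contrapT => /not_orP[].
    move=> /existsNP[x /not_implyP[x1 nx]] /existsNP[y /not_implyP[y1 ny]].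
    have [|||/nx|/ny] // :=
        @loc_rot_lp_diag _ _ _ _ p1 mid [set x] [set y] a b.
    + by move=> _ ->.
    + by move=> _ ->.
    rewrite ab; apply: sub_loc_rot (W _ (lp_diag_unit p1 x1 y1)).
    by move=> _ [_ -> [_ -> <-]].
(* The strongest property that holds fixes the indices: [U_L] and [L_M] yield the weaker
   conclusions, and the stronger hypotheses are false. *)
have [U|nU] := pselect (WUR (lp_sum p1 X Y) k).
  have [k1 [k2 [k12 [UX UY]]]] := splitU U; exists k1, k2; split => //.
  by split => // _; split; auto.
have [L|nL] := pselect (WLUR (lp_sum p1 X Y) k).
  have /split_local[k1 [k2 [k12 [/WLURP LX /WLURP LY]]]] := (WLURP _ _).1 L.
  by exists k1, k2; split => //; split => // _; split; auto.
have [M|nM] := pselect (WMLUR (lp_sum p1 X Y) k).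
  have /split_local[k1 [k2 [k12 [/WMLURP MX /WMLURP MY]]]] := (WMLURP _ _).1 M.
  by exists k1, k2; split => //; split => // _; split; auto.
(* All three hypotheses fail, so any admissible pair will do. *)
by exists 1%N, k; split; split => //; lia.
Qed.
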